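(* Let $F = F^{\times} \times \mathcal F(P)$ be a factorial monoid and $H \subset F$ a seminormal C-monoid with $H^{\times} = H \cap F^{\times}$ which is dense in $F$. Write $\mathcal C = \mathcal C(H,F)$, $\mathcal C^* = \mathcal C^*(H,F)$, and let $\mathsf E(\mathcal C) = \mathsf E(\mathcal C^* ) = \{e_0, \ldots, e_n\}$ (distinct), where $n \in \mathbb N$, $e_0 = [1]$ and $e_0 + \ldots + e_n = e_n$. For $i \in [0,n]$ let $\mathcal C_i = \mathcal C_{e_i}$ and $\mathcal C_i^* = \mathcal C^*_{e_i}$ be the constituent groups of $e_i$ in $\mathcal C$ resp. $\mathcal C^*$. Let $\mathcal C_H = \{[y] \mid y \in H\}$ and $\mathcal C_{F^{\times}}(H,F) = \{[\epsilon] \mid \epsilon \in F^{\times}\}$ (a group). Suppose that every class of $\mathcal C^*$ contains an element of $P$. For $i \in [0,n]$ let $\varphi_i \colon \mathcal C_{F^{\times}}(H,F) \to \mathcal C_i^*$, $\varphi_i([\epsilon]) = [\epsilon] + e_i$, and $\mathcal C_i' = \mathcal C_i^*/\varphi_i(\mathcal C_{F^{\times}}(H,F))$. For distinct $i,j \in [0,n]$ let $\phi_{i,j} \colon \mathcal C_i^* \to \mathcal C_i^* + \mathcal C_j^*$, $\phi_{i,j}(g) = g + e_j$. Then $H$ is half-factorial if and only if the following hold: (P1) $|\mathcal C_n'| \le 2$. (P2) For every $i \in [0,n]$: $\phi_{i,n}^{-1}\big(\varphi_n(\mathcal C_{F^{\times}}(H,F))\big) = \varphi_i(\mathcal C_{F^{\times}}(H,F))$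 if $e_i \in \mathcal C_H$, and $\phi_{i,n}^{-1}\big(\varphi_n(\mathcal C_{F^{\times}}(H,F))\big) = \mathcal C_i$ if $e_i \notin \mathcal C_H$. (P3) For distinct $i,j \in [0,n]$ with $e_i, e_j \in \mathcal C_H$: $\ker(\phi_{i,j} \circ \varphi_i) = \ker(\varphi_i) + \ker(\varphi_j)$ (kernels taken as subgroups of $\mathcal C_{F^{\times}}(H,F)$, i.e. the preimages of the identity elements $e_i+e_j$, $e_i$, $e_j$ respectively). (P4) $\mathsf E(\mathcal C^* ) \setminus \mathcal C_H$ is additively closed, and for distinct $i_1, i_2, j \in [0,n]$ with $e_{i_1}, e_{i_2} \in \mathcal C_H$, $e_j \in \mathsf E(\mathcal C^* ) \setminus \mathcal C_H$ and $e_{i_1} + e_{i_2} + e_j \in \mathcal C_H$, we have $e_{i_1} + e_j \in \mathcal C_H$ or $e_{i_2} + e_j \in \mathcal C_H$.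
   Context: All semigroups are commutative with identity; a monoid is a cancellative such semigroup; $H^{\times}$ is the unit group, $\mathsf q(H)$ the quotient group, and $[a,b]$ denotes the set of integers between $a$ and $b$. A factorial monoid is $F = F^{\times} \times \mathcal F(P)$ with $\mathcal F(P)$ the free abelian monoid on the set $P$ of primes; $\mathsf v_p$ is the $p$-adic exponent. For a submonoid $H \subset F$, $y \sim y'$ ($H$-equivalence) if for all $x \in F$: $xy \in H \iff xy' \in H$; $[y]$ is the class of $y$; $\mathcal C(H,F) = \{[y] \mid y \in F\}$ is the class semigroup (additive, identity $[1]$), $\mathcal C^*(H,F) = \{[y] \mid y \in (F\setminus F^{\times}) \cup \{1\}\}$ the reduced class semigroup; $\mathsf E(\cdot)$ denotes the set of idempotents. $H$ is a C-monoid (in $F$) if $H^{\times} = H \cap F^{\times}$ and $\mathcal C^*(H,F)$ is finite; $H$ is dense in $F$ if $\mathsf v_p(H)$ is a numerical monoid for every $p \in P$. $H$ is seminormal if every $x \in \mathsf q(H)$ with $x^n \in H$ for all sufficiently large $n$ lies in $H$. For an idempotent $e$ of a commutative semigroup $\mathcal C$, the constituent group is $\mathcal C_e = \{x \in \mathcal C \mid x+e = x \text{ and } x+y = e \text{ for some } y \in \mathcal C\}$. An atom of $H$ is a non-unit not a product of two non-units; $H$ is half-factorial if any two factorizations of an element of $H$ into atoms have the same number of factors (every element of a C-monoid has a factorization into atoms). *)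

(* Defs.v *)
(* the free abelian monoid F(P) is modelled by finmap's {mset P}. *)
From HB Require Import structures.
From mathcomp Require Import all_boot all_algebra.
From mathcomp Require Import finmap multiset.

Set Implicit Arguments.
Unset Strict Implicit.
Unset Printing Implicit Defensive.

Import GRing.Theory.
Local Open Scope ring_scope.
Local Open Scope mset_scope.

Section FactorialMonoid.
(* F^x is an abelian group U (written additively), P is the set of primes. *)
Variables (U : zmodType) (P : choiceType).

Definition FM : Type := (U * {mset P})%type.

Definition fmul (x y : FM) : FM := (x.1 + y.1, (x.2 `+` y.2)%mset).
Definition fone : FM := (0, mset0).
Definition fexp (x : FM) (k : nat) : FM := iter k (fmul x) fone.
Definition fprod (s : seq FM) : FM := foldr fmul fone s.

Definition funit (x : FM) : Prop := x.2 = mset0.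
Definition fprime (p : P) : FM := (0, [mset p]).
Definition vp (p : P) (x : FM) : nat := x.2 p.

Variable H : FM -> Prop.

Definition submonoid : Prop :=
  H fone /\ forall x y, H x -> H y -> H (fmul x y).

Definition Hunit (x : FM) : Prop := H x /\ exists y, H y /\ fmul x y = fone.
Definition units_cond : Prop := forall x, Hunit x <-> (H x /\ funit x).

Definition atom (a : FM) : Prop :=
  H a /\ ~ Hunit a /\
  forall b c, H b -> H c -> a = fmul b c -> Hunit b \/ Hunit c.

Definition half_factorial : Prop :=
  forall a (s t : seq FM), H a ->
    (forall u, u \in s -> atom u) -> (forall u, u \in t -> atom u) ->
    fprod s = a -> fprod t = a -> size s = size t.

(* x = a b^{-1} in q(H), a b in H; x^k \in H means a^k = h b^k with h in H. *)
Definition seminormal : Prop :=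
  forall a b, H a -> H b ->
    (exists N, forall k, (N <= k)%N -> exists h, H h /\ fexp a k = fmul h (fexp b k)) ->
    exists h, H h /\ a = fmul h b.

Definition numerical_monoid (S : nat -> Prop) : Prop :=
  S 0%N /\ (forall m k, S m -> S k -> S (m + k)%N) /\
  exists N, forall m, (N <= m)%N -> S m.

Definition dense : Prop :=
  forall p : P, numerical_monoid (fun m => exists h, H h /\ vp p h = m).

Definition heq (y y' : FM) : Prop := forall x, H (fmul x y) <-> H (fmul x y').

Definition Cls : Type := FM -> Prop.
Definition cls (y : FM) : Cls := fun z => heq y z.

Definition cadd (X Y : Cls) : Cls :=
  fun z => exists x y, X x /\ Y y /\ heq (fmul x y) z.

Definition inC (X : Cls) : Prop := exists y, X = cls y.
Definition inCstar (X : Cls) : Prop :=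
  exists y, (~ funit y \/ y = fone) /\ X = cls y.

Definition C_monoid : Prop :=
  units_cond /\
  exists (k : nat) (f : nat -> Cls), forall X, inCstar X -> exists2 i, (i < k)%N & X = f i.

Definition idem (inS : Cls -> Prop) (X : Cls) : Prop := inS X /\ cadd X X = X.

Definition cgroup (inS : Cls -> Prop) (e : Cls) (X : Cls) : Prop :=
  inS X /\ cadd X e = X /\ exists Y, inS Y /\ cadd X Y = e.

Definition inCH (X : Cls) : Prop := exists y, H y /\ X = cls y.
Definition inCU (X : Cls) : Prop := exists u : U, X = cls (u, mset0).

Definition in_phi_img (e : Cls) (Y : Cls) : Prop :=
  exists X, inCU X /\ Y = cadd X e.

Definition ker_phi (e : Cls) (X : Cls) : Prop := inCU X /\ cadd X e = e.

Definition coset (e : Cls) (g : Cls) (h : Cls) : Prop :=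
  cgroup inCstar e h /\ exists Y, in_phi_img e Y /\ h = cadd g Y.

End FactorialMonoid.

(* Main.v *)
(* Since [1] contains a prime, C = C*, and seminormality makes the finite
   semigroup C a union of groups, of some exponent m. Every constituent group
   meets C_H in at most its idempotent, so C_H consists of idempotents.

   If H is half-factorial, each of (P1)-(P4) follows by exhibiting, for a
   violation, two factorizations of different lengths of one product of primes
   taken from suitable classes.

   Conversely, give a prime p of class g, with idempotent e, the weight 1/2 if
   g + e_n is not in the image of C_{F^x}; otherwise give it the weight 1 if e
   is in C_H and 0 if not. By (P1) elements of H have integral weight, by (P4)
   only units of H have weight 0, and an element of H of weight at least 2 splits
   in H: (P4) assigns the primes of weight 0 to one of two parts, (P2) makes each
   part a twist of an element of H by a unit of F, and (P3) distributes the
   units. So atoms have weight 1 and the weight is the length function. *)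
Require Import Defs.
From Stdlib Require Import Setoid Morphisms.
From mathcomp Require Import all_boot all_algebra.
From mathcomp Require Import finmap multiset.
From mathcomp Require Import boolp.

Set Implicit Arguments.
Unset Strict Implicit.
Unset Printing Implicit Defensive.

Import GRing.Theory.

Local Notation "x ** y" := (fmul x y) (at level 40, left associativity).

(** * Arithmetic in the factorial monoid *)

Section FreeMonoid.
Variables (U : zmodType) (P : choiceType).
Implicit Types (x y a b c : FM U P) (u v : U) (p q : P).

Definition ofU u : FM U P := (u, mset0).

Lemma fmulC x y : x ** y = y ** x.
Proof. by rewrite /fmul addrC msetDC. Qed.

Lemma fmulA x y a : x ** (y ** a) = x ** y ** a.
Proof. by rewrite /fmul /= addrA msetDA. Qed.

Lemma fmul1 x : x ** fone U P = x.
Proof. by case: x => u m; rewrite /fmul /= addr0 msetD0. Qed.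

Lemma f1mul x : fone U P ** x = x.
Proof. by rewrite fmulC fmul1. Qed.

Lemma fmulI a x y : a ** x = a ** y -> x = y.
Proof.
case: a x y => [u m] [v k] [w l] [/addrI -> /(congr1 (fun t => msetB t m))].
by rewrite !(msetDC m) !msetDKBC => ->.
Qed.

Lemma ofU0 : ofU 0 = fone U P. Proof. by []. Qed.

Lemma ofUD u v : ofU u ** ofU v = ofU (u + v).
Proof. by rewrite /fmul /ofU /= msetD0. Qed.

Lemma ofUN u : ofU u ** ofU (- u) = fone U P.
Proof. by rewrite ofUD subrr. Qed.

Lemma ofUK u x : ofU (- u) ** (ofU u ** x) = x.
Proof. by rewrite fmulA ofUD addNr ofU0 f1mul. Qed.

Lemma funitP x : funit x <-> x = ofU x.1.
Proof. by case: x => u m; split=> [mE | [->]] //; rewrite /ofU -mE. Qed.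

Lemma fexp0 x : fexp x 0 = fone U P. Proof. by []. Qed.

Lemma fexpS x k : fexp x k.+1 = x ** fexp x k. Proof. by []. Qed.

Lemma fexp1 x : fexp x 1 = x. Proof. exact: fmul1. Qed.

Lemma fexpD x k l : fexp x (k + l) = fexp x k ** fexp x l.
Proof. by elim: k => [|k IHk]; rewrite ?f1mul // addSn !fexpS IHk fmulA. Qed.

Lemma fexpM x k l : fexp x (k * l) = fexp (fexp x k) l.
Proof. by elim: l => [|l IHl]; rewrite ?muln0 // mulnS fexpD IHl. Qed.

(* Products are compared through their lists of variables: [fac] proves any
   equation of commutative monoids between explicit products. *)
Inductive fterm := FVar of nat | FMul of fterm & fterm | FOne.

Fixpoint feval (env : seq (FM U P)) t :=
  match t with
  | FVar i => nth (fone U P) env i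
  | FMul s t => feval env s ** feval env t
  | FOne => fone U P
  end.

Fixpoint fvars t :=
  match t with
  | FVar i => [:: i]
  | FMul s t => fvars s ++ fvars t
  | FOne => [::]
  end.

Lemma fprod_cat (s t : seq (FM U P)) : Defs.fprod (s ++ t) = Defs.fprod s ** Defs.fprod t.
Proof. by elim: s => [|x s IHs] /=; rewrite ?f1mul // IHs fmulA. Qed.

Lemma fprod_perm (s t : seq (FM U P)) : perm_eq s t -> Defs.fprod s = Defs.fprod t.
Proof.
elim: s t => [|x s IHs] t; first by move/perm_size; case: t.
move=> st; have /splitPr tE : x \in t by rewrite -(perm_mem st) mem_head.
case: tE st => t1 t2; rewrite perm_sym -cat1s perm_catCA perm_cons perm_sym.
by move=> /IHs /= ->; rewrite !fprod_cat /= !fmulA (fmulC x).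
Qed.

Lemma feval_eq env s t : perm_eq (fvars s) (fvars t) -> feval env s = feval env t.
Proof.
have evE r : feval env r = Defs.fprod [seq nth (fone U P) env i | i <- fvars r].
  by elim: r => [i | r IHr r' IHr' |] /=; rewrite ?fmul1 // IHr IHr' map_cat fprod_cat.
by move=> st; rewrite !evE; apply: fprod_perm; apply: perm_map.
Qed.

End FreeMonoid.

Ltac ffind x l :=
  lazymatch l with
  | x :: _ => constr:(0%N)
  | _ :: ?l' => let k := ffind x l' in constr:(S k)
  end.
Ltac fadd x l :=
  match l with
  | _ => let k := ffind x l in constr:(l)
  | _ => constr:(x :: l)
  end.
Ltac fcollect t l :=
  lazymatch t with
  | fmul ?a ?b => let l1 := fcollect b l in fcollect a l1
  | fone _ _ => constr:(l)
  | _ => fadd t l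
  end.
Ltac freify t l :=
  lazymatch t with
  | fmul ?a ?b => let s := freify a l in let r := freify b l in constr:(FMul s r)
  | fone _ _ => constr:(FOne)
  | _ => let k := ffind t l in constr:(FVar k)
  end.
Ltac fac :=
  lazymatch goal with
  | |- @eq _ ?s ?t =>
    let T := type of s in
    let l0 := fcollect t (@nil T) in
    let l := fcollect s l0 in
    let s' := freify s l in
    let t' := freify t l in
    exact: (@feval_eq _ _ l s' t' isT)
  end.

(** * Prime divisors and induction on prime factors *)

Section PrimeFactors.
Variables (U : zmodType) (P : choiceType).
Implicit Types (x y a b c : FM U P) (u v : U) (p q : P).

Lemma fexpMn x y k : fexp (x ** y) k = fexp x k ** fexp y k.
Proof. by elim: k => [|k IHk]; rewrite ?fexp0 ?fmul1 // !fexpS IHk; fac. Qed.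

Lemma fexpC x k l : fexp (fexp x k) l = fexp (fexp x l) k.
Proof. by rewrite -!fexpM mulnC. Qed.

Lemma fexpU u k : exists v, fexp (ofU P u) k = ofU P v.
Proof.
elim: k => [|k [v IHk]]; first by exists 0%R.
by exists (u + v)%R; rewrite fexpS IHk ofUD.
Qed.

Lemma fmul_funit x y : funit (x ** y) -> funit x /\ funit y.
Proof.
rewrite /funit /= => /msetP xy; split; apply/msetP => p;
  by have := xy p; rewrite !msetE2 !mset0E; case: (x.2 p); case: (y.2 p).
Qed.

Lemma fprime_nonunit p x : ~ funit (fprime U p ** x).
Proof.
by rewrite /funit /= => /msetP/(_ p); rewrite mset1DE eqxx mset0E.
Qed.

Lemma fdvdP p x : reflect (exists y, x = fprime U p ** y) (p \in x.2).
Proof.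
apply: (iffP idP) => [px | [y ->]]; last by rewrite /= mset1D1.
by exists (x.1, (x.2 `\ p)%mset); case: x px => u m px; rewrite /fmul /= add0r msetB1K.
Qed.

(** Both cases keep track of the cofactor, so that iterating the lemma enumerates all splittings of
    an explicit product of primes. *)
Lemma fprime_split p x y w : x ** y = fprime U p ** w ->
  (exists2 x', x = fprime U p ** x' & w = x' ** y) \/
  (exists2 y', y = fprime U p ** y' & w = x ** y').
Proof.
move=> xyE; have: p \in (x ** y).2 by apply/fdvdP; exists w.
rewrite in_msetD => /orP[] /fdvdP[t tE]; [left | right]; exists t => //;
  by apply: (@fmulI _ _ (fprime U p)); rewrite -xyE tE; fac.
Qed.

Lemma fprime_ind (Q : FM U P -> Prop) :
  (forall u, Q (ofU P u)) -> (forall p x, Q x -> Q (fprime U p ** x)) ->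
  forall x, Q x.
Proof.
move=> QU Qp [u m]; move E: (size m) => k.
elim: k m E => [|k IHk] m mk.
  suff -> : m = mset0 by exact: QU.
  by rewrite -(seq_mset_id m) (size0nil mk); apply/msetP => p; rewrite mset_seqE mset0E.
move mE: (enum_mset m) mk => [//|p s] [sk].
suff -> : (u, m) = fprime U p ** (u, seq_mset s).
  by apply: Qp; apply: IHk; rewrite (perm_size (perm_eq_seq_mset s)).
by rewrite /fmul /= add0r -mset_cons -mE seq_mset_id.
Qed.

End PrimeFactors.

(** * $H$-equivalence and periodicity of the class semigroup *)

Section ClassSemigroup.
Variables (U : zmodType) (P : choiceType) (H : FM U P -> Prop).
Implicit Types (x y w a b c : FM U P) (u v : U) (p q : P).

Local Notation "x =~ y" := (heq H x y) (at level 70).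

Lemma heq_refl x : x =~ x. Proof. by []. Qed.
Hint Resolve heq_refl : core.

Global Instance heq_equiv : Equivalence (heq H).
Proof.
split=> [x w //| x y xy w | x y w xy yw t]; first by split=> /xy.
by rewrite xy.
Qed.

Global Instance fmul_heq : Proper (heq H ==> heq H ==> heq H) (@fmul U P).
Proof.
move=> x x' xx y y' yy w.
have -> : w ** (x ** y) = w ** y ** x by fac.
have -> : w ** (x' ** y') = w ** x' ** y' by fac.
by rewrite (xx (w ** y)) -(yy (w ** x')); have -> : w ** y ** x' = w ** x' ** y by fac.
Qed.

Global Instance mem_heq : Proper (heq H ==> iff) H.
Proof. by move=> x y /(_ (fone U P)); rewrite !f1mul. Qed.

Global Instance fexp_heq : Proper (heq H ==> eq ==> heq H) (@fexp U P).
Proof.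
move=> x y xy k _ <-; elim: k => [|k IHk]; first by [].
by rewrite !fexpS IHk xy.
Qed.

Lemma cls_eq x y : cls H x = cls H y <-> x =~ y.
Proof.
split=> [xy | xy]; last by rewrite predeqE /cls => t; rewrite xy.
have: cls H y y by exact: heq_refl.
by rewrite -xy.
Qed.

Lemma cadd_cls x y : cadd H (cls H x) (cls H y) = cls H (x ** y).
Proof.
rewrite predeqE => t; split=> [[x' [y' [xx [yy xyt]]]] | xyt].
  by move: xx yy xyt; rewrite /cls => -> ->.
by exists x, y; split; [exact: heq_refl | split; [exact: heq_refl |]].
Qed.

Lemma inCH_cls x : inCH H (cls H x) <-> H x.
Proof.
by split=> [[y [Hy /cls_eq ->]] // | Hx]; exists x.
Qed.

(** Multiplying $y$ by a prime of class $[1]$ gives a non-unit in the class of $y$, so the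
    hypothesis on $\mathcal C^*$ reaches every class. *)
Lemma prime_in_class :
  (forall X, inCstar H X -> exists p, X (fprime U p)) ->
  forall y, exists p, y =~ fprime U p.
Proof.
move=> CP y.
have [|p0 p0E] := CP (cls H (fone U P)); first by exists (fone U P); split; [right |].
have [|p pE] := CP (cls H (fprime U p0 ** y)).
  by exists (fprime U p0 ** y); split; [left; apply: fprime_nonunit |].
by exists p; rewrite -pE; move: p0E; rewrite /cls => <-; rewrite f1mul.
Qed.

Hypothesis Hmon : submonoid H.

Lemma mem1 : H (fone U P). Proof. by case: Hmon. Qed.

Lemma memM x y : H x -> H y -> H (x ** y). Proof. by case: Hmon => _; apply. Qed.

Lemma memX x k : H x -> H (fexp x k).
Proof. by move=> Hx; elim: k => [|k IHk]; [exact: mem1 | exact: memM]. Qed.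

(** Writing $w = w^{m+1}/w^m$ shows $w \in \mathsf q(H)$, so seminormality applies to $w$. *)
Lemma seminormal_root : seminormal H ->
  forall w m, (forall j, (m <= j)%N -> H (fexp w j)) -> H w.
Proof.
move=> Hsn w m Hw.
have [|h [Hh hE]] := Hsn (fexp w m.+1) (fexp w m) (Hw _ (leqnSn m)) (Hw _ (leqnn m)).
  exists m => k mk; exists (fexp w k); split; first exact: Hw.
  by rewrite -!fexpM mulSn fexpD.
suff -> : w = h by [].
by apply: (@fmulI _ _ (fexp w m)); rewrite fmulC -fexpS hE fmulC.
Qed.

(** By pigeonhole the powers of $y$ are eventually periodic up to equivalence. Hence $w y^{m+1}$ and
    $w y$ have equivalent high powers for every $w$, and [seminormal_root] descends from the powers
    to the elements themselves. *)
Lemma seminormal_clifford : seminormal H ->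
  (exists (k : nat) (f : nat -> Cls U P),
     forall y, exists2 i, (i < k)%N & cls H y = f i) ->
  exists2 m, (1 < m)%N & forall y, fexp y m.+1 =~ y.
Proof.
(* The factorial is a multiple of every possible period $b - a \le k$, and [k.+2] makes it exceed
   1. *)
move=> Hsn [k [f fP]]; exists k.+2`!.
  by rewrite (leq_trans _ (fact_geq k.+2)).
move=> y; set m := k.+2`!.
suff per j : (k <= j)%N -> fexp y (j + m) =~ fexp y j.
  have perM i j : (k <= j)%N -> fexp y (j + m * i) =~ fexp y j.
    move=> kj; elim: i => [|i IHi]; first by rewrite muln0 addn0.
    by rewrite mulnS addnCA addnC per // (leq_trans kj) ?leq_addr.
  have perX w j : (k <= j)%N -> fexp (w ** fexp y m.+1) j =~ fexp (w ** y) j.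
    by move=> kj; rewrite fexpMn -fexpM mulSn perM ?fexpMn.
  move=> w; split=> Hw; apply: (seminormal_root Hsn (m := k)) => j kj.
    by rewrite -perX //; exact: memX.
  by rewrite perX //; exact: memX.
(* Two of the $k+1$ powers $y^0, \ldots, y^k$ share one of the $k$ classes. *)
have hP (i : 'I_k.+1) : exists l : 'I_k, cls H (fexp y i) = f l.
  by have [l lk lE] := fP (fexp y i); exists (Ordinal lk).
have [h hE] := choice hP.
have [a [b [ab abE]]] : exists a b : 'I_k.+1, (a < b)%N /\ fexp y a =~ fexp y b.
  have /injectivePn[a [b ab hab]] : ~~ injectiveb h.
    by apply: contraTN isT => /injectiveP/leq_card; rewrite !card_ord ltnn.
  have abE : fexp y a =~ fexp y b by apply/cls_eq; rewrite !hE hab.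
  have: (a : nat) != b by [].
  by rewrite neq_ltn => /orP[ltab | ltba]; [exists a, b | exists b, a; split=> //; symmetry].
move=> kj; have /dvdnP[q mE] : (b - a %| m)%N.
  by apply: dvdn_fact; rewrite subn_gt0 ab (leq_trans (leq_subr _ _)) // ltnW // ltnS ltnW.
rewrite mE; elim: q {mE} => [|q IHq]; first by rewrite addn0.
rewrite -IHq mulSn.
have aj : (a <= j + q * (b - a))%N.
  by rewrite (leq_trans _ (leq_addr _ _)) // (leq_trans _ kj) // -ltnS.
have -> : (j + (b - a + q * (b - a)) = b + (j + q * (b - a) - a))%N.
  by rewrite addnCA -{1}(subnKC aj) addnA subnK // ltnW.
by rewrite fexpD -abE -fexpD subnKC //.
Qed.

End ClassSemigroup.

(** * The class semigroup as a union of groups *)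

Section Clifford.
Variables (U : zmodType) (P : choiceType) (H : FM U P -> Prop) (m : nat).
Implicit Types (x y a b c : FM U P) (u v w : U) (p q r s : P).

Local Notation "x =~ y" := (heq H x y) (at level 70).
Local Notation ofU := (ofU P).
Local Notation pr := (fprime U).
(* [idp y] and [inv y] represent the idempotent and the inverse of the class of
   [y] in its constituent group. *)
Local Notation idp y := (fexp y m).
Local Notation inv y := (fexp y m.-1).
Hint Resolve heq_refl : core.

Hypothesis Hmon : submonoid H.
Hypothesis m_gt1 : (1 < m)%N.
Hypothesis clifford : forall y, fexp y m.+1 =~ y.

(* Let e be the idempotent of the constituent group of [y]. Then [idem_mem y]
   says that e lies in C_H, and [twist_mem y] says moreover that the class of
   [y] lies in the image of C_{F^x} in this group. *)
Definition twist_mem y := exists u, H (ofU u ** y).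
Definition idem_mem y := H (idp y).

Local Notation T := twist_mem.
Local Notation K := idem_mem.

Lemma mul_inv y : y ** inv y = idp y.
Proof. by rewrite -fexpS prednK // ltnW. Qed.

Lemma mul_idp y : y ** idp y =~ y.
Proof. by rewrite -fexpS clifford. Qed.

Lemma idp_idem y : idp y ** idp y =~ idp y.
Proof.
rewrite -{1}mul_inv; have -> : y ** inv y ** idp y = y ** idp y ** inv y by fac.
by rewrite mul_idp mul_inv.
Qed.

Lemma fexp_idem y k : y ** y =~ y -> fexp y k.+1 =~ y.
Proof.
by move=> yy; elim: k => [|k IHk]; rewrite ?fexp1 // fexpS IHk.
Qed.

Lemma idp_fix y : y ** y =~ y -> idp y =~ y.
Proof. by move=> yy; case: m m_gt1 => // k _; apply: fexp_idem. Qed.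

Lemma inv_fix y : y ** y =~ y -> inv y =~ y.
Proof. by move=> yy; case: m m_gt1 => [//|[//|k]] _; apply: fexp_idem. Qed.

Lemma idpK y : idp (idp y) =~ idp y.
Proof. by apply: idp_fix; apply: idp_idem. Qed.

Lemma invK y : inv (inv y) =~ y.
Proof.
have idp_inv : idp (inv y) =~ idp y.
  by rewrite fexpC; apply: inv_fix; apply: idp_idem.
rewrite -(mul_idp (inv (inv y))) fexpC idp_inv.
rewrite (inv_fix (idp_idem y)) -mul_inv.
have -> : inv (inv y) ** (y ** inv y) = y ** (inv y ** inv (inv y)) by fac.
by rewrite mul_inv idp_inv mul_idp.
Qed.

(** If $w x^2 \in H$, then multiplying by $x^{m-1} \in H$ gives $w x^{m+1} \in H$, and $w x^{m+1}
    \sim w x$. *)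
Lemma mem_idem x : H x -> x ** x =~ x.
Proof.
move=> Hx w; split=> Hw.
  rewrite -(clifford x) -(prednK (ltnW m_gt1)) !fexpS.
  have -> : w ** (x ** (x ** inv x)) = w ** (x ** x) ** inv x by fac.
  by apply: memM => //; apply: memX.
by rewrite fmulA; apply: memM.
Qed.

Lemma mem_idp x : H x -> idp x =~ x.
Proof. by move=> Hx; apply: idp_fix; apply: mem_idem. Qed.

(** Cancel $u$ in $u \cdot u^m \sim u$. Thus twisting by a unit of $F$ does not change the
    idempotent. *)
Lemma idpU u : idp (ofU u) =~ fone U P.
Proof.
have -> : idp (ofU u) = ofU (- u) ** (ofU u ** idp (ofU u)) by rewrite ofUK.
by rewrite mul_idp fmulC ofUN.
Qed.

Lemma idp_twist u x : idp (ofU u ** x) =~ idp x.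
Proof. by rewrite fexpMn idpU f1mul. Qed.

Lemma invU u : inv (ofU u) =~ ofU (- u).
Proof.
have -> : inv (ofU u) = ofU (- u) ** (ofU u ** inv (ofU u)) by rewrite ofUK.
by rewrite mul_inv idpU fmul1.
Qed.

Lemma mem_eq x y : H x -> H y -> idp x =~ idp y -> x =~ y.
Proof. by move=> /mem_idp xE /mem_idp yE; rewrite xE yE. Qed.

(** This is the passage between the kernels of the $\varphi_i$ and membership in $H$. *)
Lemma mem_twist x u : H x -> H (ofU u ** x) <-> ofU u ** x =~ x.
Proof.
move=> Hx; split=> [Hux | ->] //; apply: mem_eq => //.
exact: idp_twist.
Qed.

Global Instance twist_mem_heq : Proper (heq H ==> iff) T.
Proof. by move=> x y xy; split=> -[u]; [rewrite xy | rewrite -xy] => ?; exists u. Qed.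

Global Instance idem_mem_heq : Proper (heq H ==> iff) K.
Proof. by move=> x y xy; rewrite /K xy. Qed.

Lemma twist_memW x : H x -> T x.
Proof. by exists 0%R; rewrite ofU0 f1mul. Qed.

Lemma twist_memU u x : T (ofU u ** x) <-> T x.
Proof.
split=> -[v Hv]; first by exists (v + u)%R; rewrite -ofUD -fmulA.
by exists (v - u)%R; rewrite fmulA ofUD subrK.
Qed.

Lemma twist_memM x y : T x -> T y -> T (x ** y).
Proof.
move=> [u Hu] [v Hv]; exists (u + v)%R; rewrite -ofUD.
have -> : ofU u ** ofU v ** (x ** y) = (ofU u ** x) ** (ofU v ** y) by fac.
exact: memM.
Qed.

Lemma twist_memX x k : T x -> T (fexp x k).
Proof.
move=> [u Hu]; have [v vE] := fexpU P u k; exists v.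
by rewrite -vE -fexpMn; apply: memX.
Qed.

Lemma twist_mem_idem x : T x -> K x.
Proof. by move=> [u /(memX Hmon m)]; rewrite idp_twist. Qed.

(** A twist of $y$ that lies in $H$ must represent the idempotent $[f]$ of its group, by
    [mem_eq]. *)
Lemma twist_memE f y : H f -> idp y =~ idp f -> T y <-> exists u, y =~ ofU u ** f.
Proof.
move=> Hf yf; split=> [[u Hu] | [u ->]]; last exact/twist_memU/twist_memW.
exists (- u)%R; rewrite -(mem_eq Hu Hf) ?ofUK //.
by rewrite idp_twist.
Qed.

Lemma idem_memW x : H x -> K x.
Proof. exact: memX. Qed.

Lemma idem_memM x y : K x -> K y -> K (x ** y).
Proof. by rewrite /K fexpMn; apply: memM. Qed.

Lemma idem_memU u x : K (ofU u ** x) <-> K x.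
Proof. by rewrite /K idp_twist. Qed.

(** * Atoms with at most four prime factors *)

Hypothesis Hunits : units_cond H.
Hypothesis Hprimes : forall y, exists p, y =~ pr p.

Lemma atomI a : H a -> ~ funit a ->
  (forall b c, H b -> H c -> a = b ** c -> funit b \/ funit c) -> atom H a.
Proof.
move=> Ha aN aS; split=> //; split=> [/Hunits[] // | b c Hb Hc /(aS b c Hb Hc)].
by case=> ?; [left | right]; apply/Hunits.
Qed.

Lemma ofU_split x y u : x ** y = ofU u -> exists v w, [/\ x = ofU v, y = ofU w & u = (v + w)%R].
Proof.
case: x y => [v k] [w l] [<- kl].
have [kE lE] : funit (v, k) /\ funit (w, l) by apply: fmul_funit.
by exists v, w; split=> //; congr (_, _).
Qed.

Lemma atom1 p u : H (pr p ** ofU u) -> atom H (pr p ** ofU u).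
Proof.
move=> Hp; apply: atomI => //; first exact: fprime_nonunit.
move=> b c _ _ /esym /fprime_split[] [t -> /esym/ofU_split[v [w [-> ->] _]]].
  by right.
by left.
Qed.

(** A splitting into non-units separates the two primes and distributes the unit over them. *)
Lemma atom2 p q u : H (pr p ** (pr q ** ofU u)) ->
  ~ (exists v w, [/\ u = (v + w)%R, H (pr p ** ofU v) & H (pr q ** ofU w)]) ->
  atom H (pr p ** (pr q ** ofU u)).
Proof.
move=> Hpq pqN; apply: atomI => //; first exact: fprime_nonunit.
move=> b c Hb Hc /esym /fprime_split[] [t tE /esym];
  move=> /fprime_split[] [t' t'E /esym/ofU_split[v [w [vE wE uE]]]]; subst.
- by right.
- by case: pqN; exists v, w.
- by case: pqN; exists w, v; rewrite addrC.
- by left.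
Qed.

Lemma twist_mem_of v y : H (y ** ofU v) -> T y.
Proof. by exists v; rewrite fmulC. Qed.

Lemma atom2_twist p q u : H (pr p ** (pr q ** ofU u)) ->
  ~ (T (pr p) /\ T (pr q)) -> atom H (pr p ** (pr q ** ofU u)).
Proof.
move=> Hpq pqN; apply: atom2 => // -[v [w [_ /twist_mem_of ? /twist_mem_of ?]]].
exact: pqN.
Qed.

(** Refutes an excluded splitting: the unit part of each factor witnesses [T] for its product of
    primes. *)
Local Ltac contra N v w :=
  case: N; split; solve [apply: (@twist_mem_of v); by rewrite -?fmulA |
                         apply: (@twist_mem_of w); by rewrite -?fmulA].

Lemma atom3 p q r u : H (pr p ** (pr q ** (pr r ** ofU u))) ->
  ~ (T (pr p) /\ T (pr q ** pr r)) -> ~ (T (pr q) /\ T (pr p ** pr r)) ->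
  ~ (T (pr r) /\ T (pr p ** pr q)) ->
  atom H (pr p ** (pr q ** (pr r ** ofU u))).
Proof.
move=> Hpq pN qN rN; apply: atomI => //; first exact: fprime_nonunit.
move=> b c Hb Hc /esym /fprime_split[] [t tE /esym];
  move=> /fprime_split[] [t' t'E /esym];
  move=> /fprime_split[] [t'' t''E /esym/ofU_split[v [w [vE wE uE]]]]; subst.
all: by [left | right | contra pN v w | contra qN v w | contra rN v w].
Qed.

Lemma atom4 p q r s u : H (pr p ** (pr q ** (pr r ** (pr s ** ofU u)))) ->
  ~ (T (pr p) /\ T (pr q ** (pr r ** pr s))) ->
  ~ (T (pr q) /\ T (pr p ** (pr r ** pr s))) ->
  ~ (T (pr r) /\ T (pr p ** (pr q ** pr s))) ->
  ~ (T (pr s) /\ T (pr p ** (pr q ** pr r))) ->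
  ~ (T (pr p ** pr q) /\ T (pr r ** pr s)) ->
  ~ (T (pr p ** pr r) /\ T (pr q ** pr s)) ->
  ~ (T (pr p ** pr s) /\ T (pr q ** pr r)) ->
  atom H (pr p ** (pr q ** (pr r ** (pr s ** ofU u)))).
Proof.
move=> Hpq pN qN rN sN pqN prN psN; apply: atomI => //; first exact: fprime_nonunit.
move=> b c Hb Hc /esym /fprime_split[] [t tE /esym];
  move=> /fprime_split[] [t' t'E /esym]; move=> /fprime_split[] [t'' t''E /esym];
  move=> /fprime_split[] [t3 t3E /esym/ofU_split[v [w [vE wE uE]]]]; subst.
all: by [left | right | contra pN v w | contra qN v w | contra rN v w | contra sN v w
  | contra pqN v w | contra prN v w | contra psN v w].
Qed.

Lemma atoms_cons a (s : seq (FM U P)) : atom H a -> (forall x, x \in s -> atom H x) ->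
  forall x, x \in a :: s -> atom H x.
Proof. by move=> aA sA x; rewrite inE => /orP[/eqP -> // | /sA]. Qed.

Lemma atoms_nil x : x \in [::] -> atom H x.
Proof. by []. Qed.

Lemma half_factorial_size (s t : seq (FM U P)) : half_factorial H ->
  (forall x, x \in s -> atom H x) -> (forall x, x \in t -> atom H x) ->
  Defs.fprod s = Defs.fprod t -> size s = size t.
Proof.
move=> hf sA tA st; apply: (hf (Defs.fprod s)) => //.
elim: s sA {st} => [|a s IHs] sA /=; first exact: mem1.
apply: memM => //; first by have [] := sA a (mem_head _ _).
by apply: IHs => x xs; apply: sA; rewrite inE xs orbT.
Qed.

(** * The absorbing idempotent $e_n = [z]$ *)

Variable z : FM U P.
Hypothesis Hz : H z.
Hypothesis z_absorb : forall y, z ** idp y =~ z.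

Lemma z_idem : z ** z =~ z. Proof. exact: mem_idem. Qed.

Lemma zM x y : z ** x ** (z ** y) =~ z ** (x ** y).
Proof. have -> : z ** x ** (z ** y) = z ** z ** (x ** y) by fac.
by rewrite z_idem. Qed.

Lemma twist_zM x y : T (z ** x) -> T (z ** y) -> T (z ** (x ** y)).
Proof. by move=> Tx Ty; rewrite -zM; apply: twist_memM. Qed.

Lemma z_inv x : inv (z ** x) =~ z ** inv x.
Proof. by rewrite fexpMn (inv_fix z_idem). Qed.

Lemma twist_inv y : T (inv y) <-> T y.
Proof. by split=> [/(twist_memX m.-1) | /(twist_memX m.-1)] //; rewrite invK. Qed.

Lemma twist_z_inv x : T (z ** inv x) <-> T (z ** x).
Proof. by rewrite -z_inv twist_inv. Qed.

(* (P1)-(P4) for elements of F; [z] represents e_n. *)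
Definition cond_P1 := forall x y, ~ T (z ** x) -> ~ T (z ** y) -> T (z ** (x ** y)).
Definition cond_P2 := (forall y, K y -> T (z ** y) -> T y) /\
                    (forall y, ~ K y -> T (z ** y)).
Definition cond_P3 := forall x y u, H x -> H y -> H (ofU u ** (x ** y)) ->
  exists v w, [/\ u = (v + w)%R, H (ofU v ** x) & H (ofU w ** y)].
Definition cond_P4 := (forall x y, ~ K x -> ~ K y -> ~ K (x ** y)) /\
  (forall x y d, H x -> H y -> ~ K d -> K (x ** y ** d) -> K (x ** d) \/ K (y ** d)).

Lemma inv_cancel x : z ** (x ** inv x) =~ z.
Proof. by rewrite mul_inv. Qed.

(** * Necessity of (P1)-(P4) *)

Section HalfFactorial.
Hypothesis hf : half_factorial H.

(** If $g$, $h$ and $g+h$ are all nontrivial in $\mathcal C_n'$, take primes $p_1, p_2, p_3$ in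
    classes $g, h, -(g+h)$ and $q_i$ in the inverse classes. Then $(p_1p_2p_3)(q_1q_2q_3) =
    (p_1q_1)(p_2q_2)(p_3q_3)$ has lengths 2 and 3. *)
Lemma half_factorial_P1 : cond_P1.
Proof.
move=> x y Nx Ny; apply: contrapT => Nxy.
have [p1 p1E] := Hprimes (z ** x); have [p2 p2E] := Hprimes (z ** y).
have [q1 q1E] := Hprimes (z ** inv x); have [q2 q2E] := Hprimes (z ** inv y).
have [p3 p3E] := Hprimes (z ** inv (x ** y)); have [q3 q3E] := Hprimes (z ** (x ** y)).
have Np1 : ~ T (pr p1) by rewrite -p1E.
have Np2 : ~ T (pr p2) by rewrite -p2E.
have Np3 : ~ T (pr p3) by rewrite -p3E twist_z_inv.
have Nq1 : ~ T (pr q1) by rewrite -q1E twist_z_inv.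
have Nq2 : ~ T (pr q2) by rewrite -q2E twist_z_inv.
have Nq3 : ~ T (pr q3) by rewrite -q3E.
have A1 : atom H (pr p1 ** (pr q1 ** ofU 0)).
  by apply: atom2_twist => [|[]] //; rewrite ofU0 fmul1 -p1E -q1E zM inv_cancel.
have A2 : atom H (pr p2 ** (pr q2 ** ofU 0)).
  by apply: atom2_twist => [|[]] //; rewrite ofU0 fmul1 -p2E -q2E zM inv_cancel.
have A3 : atom H (pr p3 ** (pr q3 ** ofU 0)).
  apply: atom2_twist => [|[]] //; rewrite ofU0 fmul1 -p3E -q3E zM.
  by rewrite (fmulC _ (x ** y)) inv_cancel.
have B1 : atom H (pr p1 ** (pr p2 ** (pr p3 ** ofU 0))).
  apply: atom3 => [|[]|[]|[]] //; rewrite ofU0 fmul1 -p1E -p2E -p3E !zM.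
  by rewrite (fmulA x) inv_cancel.
have B2 : atom H (pr q1 ** (pr q2 ** (pr q3 ** ofU 0))).
  apply: atom3 => [|[]|[]|[]] //; rewrite ofU0 fmul1 -q1E -q2E -q3E !zM.
  by rewrite (fmulA (inv x)) -fexpMn (fmulC _ (x ** y)) inv_cancel.
suff: 2 = 3 by [].
apply: (half_factorial_size (s := [:: _; _]) (t := [:: _; _; _]) hf
  (atoms_cons B1 (atoms_cons B2 atoms_nil))
  (atoms_cons A1 (atoms_cons A2 (atoms_cons A3 atoms_nil)))) => /=.
by rewrite !ofU0; fac.
Qed.

Lemma half_factorial_P2 : cond_P2.
Proof.
split=> y Ky.
  (* With $p$ in $[y]$, $q$ in the inverse class and $r$ in $e_n$, the product $(pru)(qru^{-1}) =
     (pq) \cdot r \cdot r$ has lengths 2 and 3. *)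
  move=> [u Hu]; apply: contrapT => Ny.
  have [p pE] := Hprimes y; have [q qE] := Hprimes (inv y); have [r rE] := Hprimes z.
  have Np : ~ T (pr p) by rewrite -pE.
  have Nq : ~ T (pr q) by rewrite -qE twist_inv.
  have A1 : atom H (pr p ** (pr r ** ofU u)).
    apply: atom2_twist => [|[]] //; rewrite -pE -rE.
    by have -> : y ** (z ** ofU u) = ofU u ** (z ** y) by fac.
  have A2 : atom H (pr q ** (pr r ** ofU (- u))).
    apply: atom2_twist => [|[]] //; rewrite -qE -rE -invU -(inv_fix z_idem) -!fexpMn.
    have -> : y ** (z ** ofU u) = ofU u ** (z ** y) by fac.
    exact: memX.
  have B1 : atom H (pr p ** (pr q ** ofU 0)).
    by apply: atom2_twist => [|[]] //; rewrite -pE -qE ofU0 fmul1 mul_inv.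
  have B2 : atom H (pr r ** ofU 0) by apply: atom1; rewrite -rE ofU0 fmul1.
  suff: 2 = 3 by [].
  apply: (half_factorial_size (s := [:: _; _]) (t := [:: _; _; _]) hf
    (atoms_cons A1 (atoms_cons A2 atoms_nil))
    (atoms_cons B1 (atoms_cons B2 (atoms_cons B2 atoms_nil)))) => /=.
  rewrite !ofU0 !fmul1.
  have -> : pr p ** (pr r ** ofU u) ** (pr q ** (pr r ** ofU (- u))) =
    pr p ** pr r ** pr q ** pr r ** (ofU u ** ofU (- u)) by fac.
  by rewrite ofUN; fac.
(* Now $r$ and $s$ are the translates of $p$ and $q$ into the group of $e_n$, and $t$ lies in $e_n$.
   The product $(ps)(qr)t = (pqt)(rs)$ has lengths 3 and 2; $pqt$ is an atom because the idempotent
   $[pq]$ is not in $\mathcal C_H$. *)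
apply: contrapT => Ny.
have [p pE] := Hprimes y; have [q qE] := Hprimes (inv y).
have [r rE] := Hprimes (z ** y); have [s sE] := Hprimes (z ** inv y).
have [t tE] := Hprimes z.
have Np : ~ T (pr p) by rewrite -pE => /twist_mem_idem.
have Nq : ~ T (pr q) by rewrite -qE twist_inv => /twist_mem_idem.
have Nr : ~ T (pr r) by rewrite -rE.
have Ns : ~ T (pr s) by rewrite -sE twist_z_inv.
have Npq : ~ T (pr p ** pr q).
  by rewrite -pE -qE mul_inv => /twist_mem_idem; rewrite /K idpK.
have A1 : atom H (pr p ** (pr s ** ofU 0)).
  apply: atom2_twist => [|[]] //; rewrite ofU0 fmul1 -pE -sE.
  have -> : y ** (z ** inv y) = z ** (y ** inv y) by fac.
  by rewrite inv_cancel.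
have A2 : atom H (pr q ** (pr r ** ofU 0)).
  apply: atom2_twist => [|[]] //; rewrite ofU0 fmul1 -qE -rE.
  have -> : inv y ** (z ** y) = z ** (y ** inv y) by fac.
  by rewrite inv_cancel.
have A3 : atom H (pr t ** ofU 0) by apply: atom1; rewrite ofU0 fmul1 -tE.
have B1 : atom H (pr p ** (pr q ** (pr t ** ofU 0))).
  apply: atom3 => [|[]|[]|[]] //; rewrite ofU0 fmul1 -pE -qE -tE.
  have -> : y ** (inv y ** z) = z ** (y ** inv y) by fac.
  by rewrite inv_cancel.
have B2 : atom H (pr r ** (pr s ** ofU 0)).
  by apply: atom2_twist => [|[]] //; rewrite ofU0 fmul1 -rE -sE zM inv_cancel.
suff: 3 = 2 by [].
apply: (half_factorial_size (s := [:: _; _; _]) (t := [:: _; _]) hf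
  (atoms_cons A1 (atoms_cons A2 (atoms_cons A3 atoms_nil)))
  (atoms_cons B1 (atoms_cons B2 atoms_nil))) => /=.
by rewrite !ofU0; fac.
Qed.

(** If neither $pqu$ nor $pqu^{-1}$ splits, then $(pqu)(pqu^{-1}) = p \cdot p \cdot q \cdot q$ has
    lengths 2 and 4. *)
Lemma half_factorial_P3 : cond_P3.
Proof.
move=> x y u Hx Hy Huxy; have [p pE] := Hprimes x; have [q qE] := Hprimes y.
have Hp : H (pr p) by rewrite -pE.
have Hq : H (pr q) by rewrite -qE.
have Hu : H (pr p ** (pr q ** ofU u)) by rewrite fmulA fmulC -pE -qE.
(* The power $m-1$ inverts the unit and fixes the idempotent classes of $p$ and $q$. *)
have HNu : H (pr p ** (pr q ** ofU (- u))).
  have := memX Hmon m.-1 Hu; rewrite !fexpMn invU.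
  by rewrite (inv_fix (mem_idem Hp)) (inv_fix (mem_idem Hq)).
have [[v [w [-> Hv Hw]]] | N1] := lem (exists v w,
    [/\ u = (v + w)%R, H (pr p ** ofU v) & H (pr q ** ofU w)]).
  by exists v, w; split=> //; rewrite fmulC ?pE ?qE.
(* A splitting of $u^{-1}$ is inverted into one of $u$ by the same power. *)
have [[v [w [uE Hv Hw]]] | N2] := lem (exists v w,
    [/\ (- u = v + w)%R, H (pr p ** ofU v) & H (pr q ** ofU w)]).
  have HN t v' : H (pr t) -> H (pr t ** ofU v') -> H (ofU (- v') ** pr t).
    move=> Ht /(memX Hmon m.-1); rewrite fexpMn invU (inv_fix (mem_idem Ht)).
    by rewrite fmulC.
  exists (- v)%R, (- w)%R; rewrite -opprD -uE opprK.
  by split=> //; rewrite ?pE ?qE; apply: HN.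
have A := atom2 Hu N1; have B := atom2 HNu N2.
have Ap : atom H (pr p ** ofU 0) by apply: atom1; rewrite ofU0 fmul1.
have Aq : atom H (pr q ** ofU 0) by apply: atom1; rewrite ofU0 fmul1.
suff: 2 = 4 by [].
apply: (half_factorial_size (s := [:: _; _]) (t := [:: _; _; _; _]) hf
  (atoms_cons A (atoms_cons B atoms_nil))
  (atoms_cons Ap (atoms_cons Ap (atoms_cons Aq (atoms_cons Aq atoms_nil))))) => /=.
have -> : pr p ** (pr q ** ofU u) ** (pr p ** (pr q ** ofU (- u)) ** fone U P) =
    pr p ** pr q ** pr p ** pr q ** (ofU u ** ofU (- u)) by fac.
by rewrite ofUN ofU0; fac.
Qed.

Lemma half_factorial_P4 : cond_P4.
Proof.
split=> [x y Kx Ky Kxy | x y d Hx Hy Kd Kxyd].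
  (* For idempotent $[p]$ and $[q]$, the product $(pq)^3 = (p^2q)(pq^2)$ has lengths 3 and 2. *)
  have [p pE] := Hprimes (idp x); have [q qE] := Hprimes (idp y).
  have pp : pr p ** pr p =~ pr p by rewrite -pE idp_idem.
  have qq : pr q ** pr q =~ pr q by rewrite -qE idp_idem.
  have Np : ~ T (pr p) by rewrite -pE => /twist_mem_idem; rewrite /K idpK.
  have Nq : ~ T (pr q) by rewrite -qE => /twist_mem_idem; rewrite /K idpK.
  have Hpq : H (pr p ** pr q) by rewrite -pE -qE -fexpMn.
  have A : atom H (pr p ** (pr q ** ofU 0)).
    by apply: atom2_twist => [|[]] //; rewrite ofU0 fmul1.
  have B1 : atom H (pr p ** (pr p ** (pr q ** ofU 0))).
    by apply: atom3 => [|[]|[]|[]] //; rewrite ofU0 fmul1 fmulA pp.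
  have B2 : atom H (pr p ** (pr q ** (pr q ** ofU 0))).
    by apply: atom3 => [|[]|[]|[]] //; rewrite ofU0 fmul1 qq.
  suff: 3 = 2 by [].
  apply: (half_factorial_size (s := [:: _; _; _]) (t := [:: _; _]) hf
    (atoms_cons A (atoms_cons A (atoms_cons A atoms_nil)))
    (atoms_cons B1 (atoms_cons B2 atoms_nil))) => /=.
  by rewrite !ofU0; fac.
(* Here $(p_1p_2q)^2 = p_1 \cdot p_2 \cdot (p_1p_2q^2)$ has lengths 2 and 3. The last factor is an
   atom since $q$, $p_1q$ and $p_2q$ have no twist in $H$ and $q^2 \sim q$. *)
apply: contrapT => /not_orP[Kxd Kyd].
have [p1 p1E] := Hprimes x; have [p2 p2E] := Hprimes y; have [q qE] := Hprimes (idp d).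
have qq : pr q ** pr q =~ pr q by rewrite -qE idp_idem.
have Hp1 : H (pr p1) by rewrite -p1E.
have Hp2 : H (pr p2) by rewrite -p2E.
have Nq : ~ T (pr q) by rewrite -qE => /twist_mem_idem; rewrite /K idpK.
have N1 : ~ T (pr p1 ** pr q).
  by rewrite -p1E -qE => /twist_mem_idem; rewrite /K fexpMn idpK -fexpMn.
have N2 : ~ T (pr p2 ** pr q).
  by rewrite -p2E -qE => /twist_mem_idem; rewrite /K fexpMn idpK -fexpMn.
have Hpq : H (pr p1 ** (pr p2 ** pr q)).
  move: Kxyd; rewrite /K !fexpMn (mem_idp Hx) (mem_idp Hy) -p1E -p2E -qE.
  by rewrite fmulA.
have A1 : atom H (pr p1 ** ofU 0) by apply: atom1; rewrite ofU0 fmul1.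
have A2 : atom H (pr p2 ** ofU 0) by apply: atom1; rewrite ofU0 fmul1.
have B : atom H (pr p1 ** (pr p2 ** (pr q ** ofU 0))).
  by apply: atom3 => [|[]|[]|[]] //; rewrite ofU0 fmul1.
have A3 : atom H (pr p1 ** (pr p2 ** (pr q ** (pr q ** ofU 0)))).
  apply: atom4; first by rewrite ofU0 fmul1 qq.
  1-7: by [case | case=> _; rewrite qq].
suff: 2 = 3 by [].
apply: (half_factorial_size (s := [:: _; _]) (t := [:: _; _; _]) hf
  (atoms_cons B (atoms_cons B atoms_nil))
  (atoms_cons A1 (atoms_cons A2 (atoms_cons A3 atoms_nil)))) => /=.
by rewrite !ofU0; fac.
Qed.

End HalfFactorial.

(* [wt] is twice the length function: an atom contains, besides primes of
   weight 0, either one prime of weight 2 or two primes of weight 1. *)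
Definition pwt p : nat :=
  if `[< T (z ** pr p) >] then (if `[< K (pr p) >] then 2 else 0) else 1.
Definition wt x : nat := \sum_(p <- x.2) pwt p.

Lemma wtM x y : wt (x ** y) = (wt x + wt y)%N.
Proof.
rewrite /wt -big_cat; apply: perm_big; apply/allP => p _ /=.
by rewrite count_cat !count_mem_mset msetE2.
Qed.

Lemma wt_unit x : funit x -> wt x = 0.
Proof. by rewrite /wt => ->; rewrite big_mset0. Qed.

Lemma wt_prime p : wt (pr p) = pwt p.
Proof. by rewrite /wt /= enum_msetn big_seq1. Qed.

Lemma twist_zMl x y : T (z ** x) -> T (z ** (x ** y)) <-> T (z ** y).
Proof.
move=> Tx; split=> [Txy | /(twist_zM Tx)] //.
have := twist_zM (iffRL (twist_z_inv x) Tx) Txy.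
have -> : z ** (inv x ** (x ** y)) = z ** (x ** inv x) ** y by fac.
by rewrite inv_cancel.
Qed.

(** * Sufficiency of (P1)-(P4) *)

Section Conditions.
Hypotheses (c1 : cond_P1) (c2 : cond_P2) (c3 : cond_P3) (c4 : cond_P4).

(** Parity of the weight is the homomorphism from $F$ to $\mathcal C_n'$, a group of order at most 2
    by (P1). *)
Lemma wt_odd x : odd (wt x) <-> ~ T (z ** x).
Proof.
elim/fprime_ind: x => [u | p x IHx].
  rewrite wt_unit //; split=> // [[]]; rewrite fmulC.
  by apply/twist_memU; apply: twist_memW.
rewrite wtM wt_prime oddD /pwt; case: asboolP => [Tp | Np].
  by rewrite twist_zMl // -IHx; case: ifP.
case: (odd (wt x)) IHx => [[/(_ isT) Nx _] | [_ Nx]] /=.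
  by split=> // -[]; apply: c1.
split=> // _ Tpx; have Tx : T (z ** x) by apply: contrapT => /Nx.
by apply: Np; move: Tpx; rewrite (fmulC (pr p)) twist_zMl.
Qed.

Lemma pwt_le2 p : (pwt p <= 2)%N.
Proof. by rewrite /pwt; case: ifP => // _; case: ifP. Qed.

(** The second half of (P2) ensures that primes of weight 1 have their idempotent in $\mathcal
    C_H$. *)
Lemma pwt_gt0 p : (0 < pwt p)%N <-> K (pr p).
Proof.
rewrite /pwt; case: asboolP => [_ | Np]; first by case: asboolP.
by split=> // _; apply: contrapT => /c2.2.
Qed.

(** A nonempty product of primes of weight 0 keeps its idempotent outside $\mathcal C_H$, by
    additive closure in (P4). *)
Lemma wt0 x : wt x = 0 -> funit x \/ ~ K x.
Proof.
elim/fprime_ind: x => [u _ | p x IHx]; first by left.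
rewrite wtM wt_prime => /eqP; rewrite addn_eq0 => /andP[/eqP p0 /eqP/IHx xE]; right.
have Kp : ~ K (pr p) by rewrite -pwt_gt0 p0.
case: xE => [/funitP -> | Kx]; last exact: c4.1.
by rewrite fmulC idem_memU.
Qed.

Lemma mem_wt_even x : H x -> ~~ odd (wt x).
Proof.
move=> Hx; apply/negP => /wt_odd; apply; apply: twist_memW; exact: memM.
Qed.

Lemma mem_wt_gt1 x : H x -> ~ funit x -> (1 < wt x)%N.
Proof.
move=> Hx xN; have := mem_wt_even Hx; case E: (wt x) => [|[]] // _.
by case: (wt0 E) => // -[]; apply: idem_memW.
Qed.

Lemma split_weightless x :
  exists y d, [/\ x = y ** d, K y & wt d = 0].
Proof.
elim/fprime_ind: x => [u | p x [y [d [-> Ky d0]]]].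
  exists (ofU u), (fone U P); rewrite fmul1 wt_unit //; split=> //.
  by rewrite -(fmul1 (ofU u)) idem_memU; apply: idem_memW; apply: mem1.
have [Kp | /pwt_gt0/negP] := lem (K (pr p)).
  by exists (pr p ** y), d; split; [fac | apply: idem_memM |].
rewrite -eqn0Ngt => /eqP p0; exists y, (pr p ** d); split=> //; first by fac.
by rewrite wtM wt_prime p0 d0.
Qed.

Lemma split_prime x : (0 < wt x)%N -> exists p y, x = pr p ** y /\ (0 < pwt p)%N.
Proof.
elim/fprime_ind: x => [u | p x IHx]; first by rewrite wt_unit.
rewrite wtM wt_prime; have [-> /IHx | p0 _] := posnP (pwt p); last by exists p, x.
by move=> [q [y [-> q0]]]; exists q, (pr p ** y); split=> //; fac.
Qed.

(** Among two primes of positive weight, one of weight 2 is taken alone; otherwise both have weight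
    1 and are taken together. *)
Lemma split_weight2 x : (1 < wt x)%N -> exists y y', [/\ x = y ** y', K y & wt y = 2].
Proof.
move=> x2; have [p [y [xE p0]]] := split_prime (ltnW x2).
have [p2 | p2] := eqVneq (pwt p) 2.
  by exists (pr p), y; split; rewrite ?wt_prime //; apply/pwt_gt0.
have p1 : pwt p = 1 by case: (pwt p) p0 p2 (pwt_le2 p) => [|[|[|]]].
have [|q [w [yE q0]]] := @split_prime y.
  by move: x2; rewrite xE wtM wt_prime p1.
have [q2 | q2] := eqVneq (pwt q) 2.
  exists (pr q), (pr p ** w); split; rewrite ?wt_prime //; last exact/pwt_gt0.
  by rewrite xE yE; fac.
have q1 : pwt q = 1 by case: (pwt q) q0 q2 (pwt_le2 q) => [|[|[|]]].
exists (pr p ** pr q), w; split; first by rewrite xE yE; fac.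
  by apply: idem_memM; apply/pwt_gt0.
by rewrite wtM !wt_prime p1 q1.
Qed.

(** Even weight makes $x$ trivial in $\mathcal C_n'$, and the first half of (P2) pulls this back to
    the group of $x$. *)
Lemma twist_mem_even x : K x -> ~~ odd (wt x) -> T x.
Proof. by move=> Kx /negP xE; apply: c2.1 => //; apply: contrapT => /wt_odd. Qed.

Lemma weight_split a : H a -> (2 < wt a)%N ->
  exists b c, [/\ H b, H c, a = b ** c, ~ funit b & ~ funit c].
Proof.
move=> Ha a2.
have wtN x : (0 < wt x)%N -> ~ funit x by move=> + /wt_unit x0; rewrite x0.
(* It suffices to split $a$ up to units: if $ub, vc \in H$, then twisting their product by $-(u+v)$
   returns $a$, and (P3) distributes this unit over the two factors. *)
suff [b [c [aE Tb Tc bN cN]]] : exists b c,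
    [/\ a = b ** c, T b, T c, ~ funit b & ~ funit c].
  case: Tb Tc => [u Hu] [v Hv].
  have [|w1 [w2 [wE Hw1 Hw2]]] := @c3 _ _ (- (u + v))%R Hu Hv.
    have -> : ofU u ** b ** (ofU v ** c) = ofU u ** ofU v ** (b ** c) by fac.
    by rewrite ofUD ofUK -aE.
  have nU w x : ~ funit x -> ~ funit (ofU w ** x) by move=> xN /fmul_funit[].
  exists (ofU w1 ** (ofU u ** b)), (ofU w2 ** (ofU v ** c)); split=> //; last 2 first.
  - by apply: (nU); apply: nU.
  - by apply: (nU); apply: nU.
  have -> : ofU w1 ** (ofU u ** b) ** (ofU w2 ** (ofU v ** c)) =
    ofU w1 ** ofU w2 ** (ofU u ** ofU v ** (b ** c)) by fac.
  by rewrite !ofUD -wE ofUK.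
have [x [w [aE Kx x2]]] := split_weight2 (ltnW a2).
have [y [d [wE Ky d0]]] := split_weightless w.
have wt_a : wt a = (2 + wt y)%N by rewrite aE wE !wtM x2 d0 addn0.
have ye : ~~ odd (wt y) by have := mem_wt_even Ha; rewrite wt_a oddD.
have y0 : (0 < wt y)%N by move: a2; rewrite wt_a -addn1 leq_add2l.
have Tx : T x by apply: twist_mem_even; rewrite ?x2.
have Ty : T y by apply: twist_mem_even.
have {}aE : a = x ** y ** d by rewrite aE wE; fac.
(* (P4), applied to twists of $x$ and $y$ in $H$, decides which of them receives $d$. If $d$ is a
   unit, either choice works. *)
have Kxyd : K (x ** d) \/ K (y ** d).
  have [/funitP -> | Kd] := wt0 d0; first by left; rewrite fmulC idem_memU.
  case: Tx Ty => [u Hu] [v Hv].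
  have [|Kd'|Kd'] := c4.2 _ _ d Hu Hv Kd; last 2 first.
  - by left; move: Kd'; rewrite -fmulA idem_memU.
  - by right; move: Kd'; rewrite -fmulA idem_memU.
  have -> : ofU u ** x ** (ofU v ** y) ** d = ofU u ** (ofU v ** (x ** y ** d)) by fac.
  by rewrite !idem_memU -aE; apply: idem_memW.
case: Kxyd => Kd.
  exists (x ** d), y; split=> //; [by rewrite aE; fac | | |].
  - by apply: twist_mem_even => //; rewrite wtM x2 d0.
  - by apply: wtN; rewrite wtM x2.
  - exact: wtN.
exists x, (y ** d); split=> //; [by rewrite aE; fac | | |].
- by apply: twist_mem_even => //; rewrite wtM d0 addn0.
- by apply: wtN; rewrite x2.
- by apply: wtN; rewrite wtM d0 addn0.
Qed.

Lemma wt_atom a : atom H a -> wt a = 2.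
Proof.
move=> [Ha [aN aS]].
have a1 : (1 < wt a)%N by apply: mem_wt_gt1 => // aU; apply: aN; apply/Hunits.
apply/eqP; rewrite eqn_leq a1 andbT leqNgt; apply/negP => a2.
have [b [c [Hb Hc aE bN cN]]] := weight_split Ha a2.
by case: (aS b c Hb Hc aE) => /Hunits[].
Qed.

Lemma cond_half_factorial : half_factorial H.
Proof.
move=> a s t _ sA tA sE tE.
have wtE (l : seq (FM U P)) : (forall x, x \in l -> atom H x) ->
    wt (Defs.fprod l) = (2 * size l)%N.
  elim: l => [|b l IHl] lA /=; first by rewrite wt_unit.
  rewrite wtM IHl => [|x xl]; last by apply: lA; rewrite inE xl orbT.
  by rewrite wt_atom ?mulnS //; apply: lA; rewrite mem_head.
by apply/eqP; rewrite -(eqn_pmul2l (isT : 0 < 2)%N) -!wtE // sE tE.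
Qed.

End Conditions.

(** * Translation of (P1)-(P4) from classes to elements of $F$ *)

Lemma inCstar_cls y : inCstar H (cls H y).
Proof.
have [p pE] := Hprimes y; exists (pr p); split; last exact/cls_eq.
by left; rewrite -(fmul1 (pr p)); apply: fprime_nonunit.
Qed.

Lemma inCstarP X : inCstar H X -> exists y, X = cls H y.
Proof. by move=> [y [_ ->]]; exists y. Qed.

Lemma idem_cls f : idem H (inCstar H) (cls H f) <-> f ** f =~ f.
Proof.
rewrite /idem cadd_cls cls_eq; split=> [[] // | ff]; split=> //.
exact: inCstar_cls.
Qed.

(** The parameter [inS] serves both $\mathcal C$ and $\mathcal C^*$. If $yf \sim y$ and $yx \sim f$,
    then $y^m \sim y^m f \sim y^m y^m x^m \sim y^m x^m \sim f$. *)
Lemma cgroup_cls (inS : Cls U P -> Prop) f y : f ** f =~ f ->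
  (forall x, inS (cls H x)) -> (forall X, inS X -> exists x, X = cls H x) ->
  cgroup H inS (cls H f) (cls H y) <-> idp y =~ f.
Proof.
move=> ff clsS Scls; rewrite /cgroup cadd_cls cls_eq; split; last first.
  move=> yf; split=> //; split; first by rewrite -yf mul_idp.
  by exists (cls H (inv y)); split=> //; rewrite cadd_cls mul_inv; apply/cls_eq.
move=> [_ [yf [_ [/Scls[x ->]]]]]; rewrite cadd_cls cls_eq => yx.
have fE : idp f =~ f by apply: idp_fix.
have: idp (y ** f) =~ idp y by rewrite yf.
have: idp (y ** x) =~ f by rewrite yx.
rewrite !fexpMn fE => yxf yf'; transitivity (idp y ** f); first by symmetry.
by rewrite -yxf fmulA idp_idem.
Qed.

Lemma cgroup_star f y : f ** f =~ f ->
  cgroup H (inCstar H) (cls H f) (cls H y) <-> idp y =~ f.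
Proof. by move=> ff; apply: cgroup_cls => // [x | X]; [apply: inCstar_cls | apply: inCstarP]. Qed.

Lemma cgroup_full f y : f ** f =~ f ->
  cgroup H (inC H) (cls H f) (cls H y) <-> idp y =~ f.
Proof. by move=> ff; apply: cgroup_cls => // x; exists x. Qed.

Lemma in_phi_img_cls f y :
  in_phi_img H (cls H f) (cls H y) <-> exists u, y =~ ofU u ** f.
Proof.
split=> [[_ [[u ->]]] | [u yE]]; first by rewrite cadd_cls cls_eq; exists u.
by exists (cls H (ofU u)); split; [exists u | rewrite cadd_cls; apply/cls_eq].
Qed.

Lemma idp_z : idp z =~ z.
Proof. exact: mem_idp. Qed.

Lemma twist_z y : T (z ** y) <-> exists u, z ** y =~ ofU u ** z.
Proof. by apply: twist_memE => //; rewrite fexpMn idp_z. Qed.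

Lemma in_phi_img_z y :
  in_phi_img H (cls H z) (cadd H (cls H y) (cls H z)) <-> T (z ** y).
Proof. by rewrite cadd_cls in_phi_img_cls fmulC twist_z. Qed.

(** Elements of the group of $e_n$ absorb $z$, so its cosets are the orbits under twisting by units
    of $F$. *)
Lemma coset_z y : idp y =~ z ->
  Defs.coset H (cls H z) (cls H y) = fun X => exists u, X = cls H (ofU u ** y).
Proof.
move=> yz; have zy : y ** z =~ y by rewrite -yz mul_idp.
rewrite predeqE => X; split.
  move=> [_ [_ [[_ [[u ->] ->]] ->]]]; exists u; rewrite !cadd_cls; apply/cls_eq.
  have -> : y ** ((u, mset0) ** z) = ofU u ** (y ** z) by rewrite /ofU; fac.
  by rewrite zy.
move=> [u ->]; split; first by apply/cgroup_star; rewrite ?z_idem // idp_twist.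
exists (cls H (ofU u ** z)); split; first by apply/in_phi_img_cls; exists u.
rewrite cadd_cls; apply/cls_eq.
have -> : y ** (ofU u ** z) = ofU u ** (y ** z) by fac.
by rewrite zy.
Qed.

Lemma coset_z_eq x y : idp x =~ z -> idp y =~ z ->
  Defs.coset H (cls H z) (cls H x) = Defs.coset H (cls H z) (cls H y) <->
  exists u, x =~ ofU u ** y.
Proof.
move=> xz yz; rewrite !coset_z //; split.
  rewrite predeqE => /(_ (cls H x))[xy _].
  have [|u /cls_eq xE] := xy; last by exists u.
  by exists 0%R; rewrite ofU0 f1mul.
move=> [u xE]; rewrite predeqE => X; split=> -[v ->].
  by exists (v + u)%R; apply/cls_eq; rewrite xE fmulA ofUD.
by exists (v - u)%R; apply/cls_eq; rewrite xE fmulA ofUD subrK.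
Qed.

Variables (n : nat) (e : nat -> Cls U P).
Hypothesis idemP : forall X, idem H (inCstar H) X <-> exists2 i, (i <= n)%N & X = e i.
Hypothesis e_n : e n = cls H z.

Lemma idem_rep i : (i <= n)%N -> exists2 f, e i = cls H f & f ** f =~ f.
Proof.
move=> i_n; have /idemP eI : exists2 j, (j <= n)%N & e i = e j by exists i.
have [f fE] := inCstarP eI.1; exists f => //.
by apply/idem_cls; rewrite -fE.
Qed.

Lemma idem_index f : f ** f =~ f -> exists2 i, (i <= n)%N & e i = cls H f.
Proof. by move=> /idem_cls/idemP[i i_n fE]; exists i. Qed.

Lemma cond_P1E : cond_P1 <->
  exists g1 g2, cgroup H (inCstar H) (e n) g1 /\ cgroup H (inCstar H) (e n) g2 /\
     forall g, cgroup H (inCstar H) (e n) g ->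
       Defs.coset H (e n) g = Defs.coset H (e n) g1 \/
       Defs.coset H (e n) g = Defs.coset H (e n) g2.
Proof.
rewrite e_n.
have grP y : cgroup H (inCstar H) (cls H z) (cls H y) <-> idp y =~ z.
  exact/cgroup_star/z_idem.
have zyP y : idp (z ** y) =~ z by rewrite fexpMn idp_z.
have zy y : idp y =~ z -> z ** y =~ y by move=> <-; rewrite fmulC mul_idp.
split=> [c1 | [_ [_ [/[dup]/proj1/inCstarP[y1 ->] /grP y1z
                   [/[dup]/proj1/inCstarP[y2 ->] /grP y2z gP]]]] x y Nx Ny].
  have triv y : idp y =~ z -> T (z ** y) ->
      Defs.coset H (cls H z) (cls H y) = Defs.coset H (cls H z) (cls H z).
    move=> yz /twist_z[u]; rewrite zy // => yE.
    by apply/coset_z_eq => //; [exact: idp_z | exists u].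
  (* The witnesses are the trivial coset and any nontrivial one; if there is none, the trivial coset
     is given twice. *)
  have [[x Nx] | allT] := lem (exists x, ~ T (z ** x)); last first.
    exists (cls H z), (cls H z); rewrite !grP idp_z; do 2 split=> //.
    move=> g /[dup]/proj1/inCstarP[y ->] /grP yz; left; apply: triv => //.
    by apply: contrapT => Ny; apply: allT; exists y.
  exists (cls H z), (cls H (z ** x)); rewrite !grP idp_z zyP; do 2 split=> //.
  move=> g /[dup]/proj1/inCstarP[y ->] /grP yz.
  have [Ty | Ny] := lem (T (z ** y)); [by left; apply: triv | right].
  apply/coset_z_eq => //.
  have /twist_z[u uE] : T (z ** (inv x ** y)) by apply: c1; rewrite ?twist_z_inv.
  exists u; rewrite fmulA -uE.
  have -> : z ** (inv x ** y) ** x = z ** (x ** inv x) ** y by fac.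
  by rewrite inv_cancel zy.
have cos a b : Defs.coset H (cls H z) (cls H (z ** a)) =
    Defs.coset H (cls H z) (cls H (z ** b)) -> exists u, z ** a =~ ofU u ** (z ** b).
  by move/coset_z_eq; apply.
have Tz : T (z ** fone U P) by rewrite fmul1; apply: twist_memW.
have key a : ~ T (z ** a) -> Defs.coset H (cls H z) (cls H (z ** a)) <>
    Defs.coset H (cls H z) (cls H (z ** fone U P)).
  by move=> Na /cos[u uE]; apply: Na; rewrite uE twist_memU.
(* Among $1$, $x$ and $y^{-1}$ two share a coset. The first differs from the others, so $x$ and
   $y^{-1}$ agree and $xy$ is trivial. *)
have Niy : ~ T (z ** inv y) by rewrite twist_z_inv.
have := gP _ (iffRL (grP _) (zyP (fone U P))).
have := gP _ (iffRL (grP _) (zyP x)); have := gP _ (iffRL (grP _) (zyP (inv y))).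
have fin : Defs.coset H (cls H z) (cls H (z ** x)) =
    Defs.coset H (cls H z) (cls H (z ** inv y)) -> T (z ** (x ** y)).
  move=> /cos[u uE]; rewrite fmulA uE.
  have -> : ofU u ** (z ** inv y) ** y = ofU u ** (z ** (y ** inv y)) by fac.
  by rewrite inv_cancel twist_memU; apply: twist_memW.
by case=> E1; case=> E2; case=> E3; first [apply: fin; congruence |
  case: (key _ Nx); congruence | case: (key _ Niy); congruence].
Qed.

(** Each equality of sets has one inclusion that holds in general; [cond_P2] records the other, with
    $y$ placed in the group of its own idempotent. *)
Lemma cond_P2E : cond_P2 <-> forall i, (i <= n)%N ->
  (inCH H (e i) ->
     forall g, (cgroup H (inCstar H) (e i) g /\ in_phi_img H (e n) (cadd H g (e n)))
               <-> in_phi_img H (e i) g) /\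
  (~ inCH H (e i) ->
     forall g, (cgroup H (inCstar H) (e i) g /\ in_phi_img H (e n) (cadd H g (e n)))
               <-> cgroup H (inC H) (e i) g).
Proof.
rewrite e_n; split=> [c2 i i_n | P2].
  have [f -> ff] := idem_rep i_n; rewrite inCH_cls; split=> Hf g; split.
  - move=> [/[dup]/proj1/inCstarP[y ->] /(cgroup_star _ ff) yf /in_phi_img_z Ty].
    apply/in_phi_img_cls; apply/twist_memE => //; first by rewrite yf idp_fix.
    by apply: c2.1 => //; rewrite /K yf.
  - move=> [_ [[u ->] ->]]; rewrite cadd_cls; split.
      by apply/cgroup_star => //; rewrite idp_twist idp_fix.
    apply/in_phi_img_z; have -> : z ** ((u, mset0) ** f) = ofU u ** (z ** f).
      by rewrite /ofU; fac.
    by apply/twist_memU/twist_memW; apply: memM.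
  - move=> [/[dup]/proj1/inCstarP[y ->] /(cgroup_star _ ff) yf _].
    exact/cgroup_full.
  - move=> /[dup]/proj1[y ->] /(cgroup_full _ ff) yf; split; first exact/cgroup_star.
    by apply/in_phi_img_z; apply: c2.2; rewrite /K yf.
split=> y Ky; have [i i_n iE] := idem_index (idp_idem y);
  have [] := P2 i i_n; rewrite iE inCH_cls.
- move=> /(_ Ky (cls H y))[+ _] _ Ty.
  rewrite in_phi_img_z cgroup_star ?in_phi_img_cls; last exact: idp_idem.
  move=> /(_ (conj (heq_refl _ _) Ty)).
  by move/twist_memE; apply=> //; rewrite idpK.
- move=> _ /(_ Ky (cls H y))[_]; rewrite in_phi_img_z cgroup_full; last exact: idp_idem.
  by move/(_ (heq_refl _ _)) => [].
Qed.

Lemma cond_P3E : cond_P3 <-> forall i j, (i <= n)%N -> (j <= n)%N -> i <> j ->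
   inCH H (e i) -> inCH H (e j) ->
   forall X, (inCU H X /\ cadd H (cadd H X (e i)) (e j) = cadd H (e i) (e j))
             <-> exists X1 X2, ker_phi H (e i) X1 /\ ker_phi H (e j) X2 /\
                               X = cadd H X1 X2.
Proof.
split=> [c3 i j i_n j_n _ | P3 x y u Hx Hy Hu].
  have [f -> ff] := idem_rep i_n; have [f' -> ff'] := idem_rep j_n.
  rewrite !inCH_cls => Hf Hf' X; split.
    move=> [[u ->]]; rewrite !cadd_cls cls_eq -/(ofU u) -fmulA => uE.
    have [|v [w [uvw Hv Hw]]] := @c3 f f' u Hf Hf'; first by rewrite uE; apply: memM.
    exists (cls H (ofU v)), (cls H (ofU w)); split; last split.
    - by split; [exists v | rewrite cadd_cls; apply/cls_eq/mem_twist].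
    - by split; [exists w | rewrite cadd_cls; apply/cls_eq/mem_twist].
    - by rewrite cadd_cls ofUD uvw.
  move=> [_ [_ [[[v ->] +] [[[w ->] +] ->]]]]; rewrite !cadd_cls !cls_eq => vE wE.
  rewrite -/(ofU v) -/(ofU w); split; first by rewrite ofUD; exists (v + w)%R.
  have -> : ofU v ** ofU w ** f ** f' = ofU v ** f ** (ofU w ** f') by fac.
  by rewrite vE wE.
(* (P3) speaks of distinct idempotents. In the case of equal classes $ux \sim uxy \in H$, so the
   whole unit goes to $x$. *)
have [xy | xy] := lem (x =~ y).
  exists u, 0%R; rewrite addr0 ofU0 f1mul; split=> //.
  by rewrite -(mem_idem Hx) {2}xy.
have [i i_n iE] := idem_index (mem_idem Hx); have [j j_n jE] := idem_index (mem_idem Hy).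
have ij : i <> j by move=> ij; apply: xy; apply/cls_eq; rewrite -iE -jE ij.
have := P3 i j i_n j_n ij; rewrite iE jE !inCH_cls => /(_ Hx Hy (cls H (ofU u)))[+ _].
rewrite !cadd_cls cls_eq -fmulA (iffLR (mem_twist _ (memM Hmon Hx Hy)) Hu).
case=> [|_ [_ [[[v ->] +] [[[w ->] +]]]]]; first by split=> //; exists u.
rewrite !cadd_cls !cls_eq -/(ofU v) -/(ofU w) => vE wE uE.
(* Only the classes of $u$ and $v + w$ agree, so [u - w] replaces [v] to get an equality of
   units. *)
exists (u - w)%R, w; rewrite subrK; split=> //; last by rewrite wE.
rewrite -ofUD uE.
have -> : ofU v ** ofU w ** ofU (- w) ** x = ofU v ** x ** (ofU w ** ofU (- w)) by fac.
by rewrite ofUN fmul1 vE.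
Qed.

Lemma cond_P4E : cond_P4 <->
  (forall X Y, idem H (inCstar H) X -> ~ inCH H X ->
               idem H (inCstar H) Y -> ~ inCH H Y ->
               idem H (inCstar H) (cadd H X Y) /\ ~ inCH H (cadd H X Y)) /\
  (forall i1 i2 j, (i1 <= n)%N -> (i2 <= n)%N -> (j <= n)%N ->
     i1 <> i2 -> i1 <> j -> i2 <> j ->
     inCH H (e i1) -> inCH H (e i2) -> ~ inCH H (e j) ->
     inCH H (cadd H (cadd H (e i1) (e i2)) (e j)) ->
     inCH H (cadd H (e i1) (e j)) \/ inCH H (cadd H (e i2) (e j))).
Proof.
have KE f : f ** f =~ f -> K f <-> H f by move=> /idp_fix ff; rewrite /K ff.
have idM f g : f ** f =~ f -> g ** g =~ g -> f ** g ** (f ** g) =~ f ** g.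
  move=> ff gg; have -> : f ** g ** (f ** g) = f ** f ** (g ** g) by fac.
  by rewrite ff gg.
split=> [[c4a c4b] | [P4a P4b]]; split.
- move=> X Y /[dup]/proj1/inCstarP[f ->] /idem_cls ff + /[dup]/proj1/inCstarP[g ->].
  move=> + /idem_cls gg; rewrite cadd_cls idem_cls !inCH_cls => Nf Ng.
  by split; [apply: idM | rewrite -KE; [apply: c4a; rewrite KE | apply: idM]].
- move=> i1 i2 j i1n i2n jn _ _ _.
  have [f -> ff] := idem_rep i1n; have [g -> gg] := idem_rep i2n.
  have [h -> hh] := idem_rep jn; rewrite !cadd_cls !inCH_cls => Hf Hg Nh Hfgh.
  have [| |Kfh|Kgh] := c4b f g h Hf Hg.
  + by rewrite KE.
  + by apply/KE => //; apply: (idM) => //; apply: idM.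
  + by left; apply/KE => //; apply: idM.
  + by right; apply/KE => //; apply: idM.
- move=> x y Kx Ky; have := P4a (cls H (idp x)) (cls H (idp y)).
  rewrite cadd_cls !idem_cls !inCH_cls => /(_ (idp_idem x) Kx (idp_idem y) Ky)[_].
  by rewrite /K fexpMn.
- move=> x y d Hx Hy Kd Kxyd.
  have Kx a : H a -> K (a ** d) <-> H (a ** idp d).
    by move=> Ha; rewrite /K fexpMn mem_idp.
  have Hxyd : H (x ** y ** idp d) by apply/Kx => //; apply: memM.
  (* If the classes agree, $xyd \sim xd$. Otherwise the three indices are distinct, that of $d$
     because its idempotent is not in $\mathcal C_H$. *)
  rewrite !Kx //; have [xy | xy] := lem (x =~ y).
    by left; rewrite -(mem_idem Hx) {2}xy.
  have [i i_n iE] := idem_index (mem_idem Hx).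
  have [j j_n jE] := idem_index (mem_idem Hy).
  have [k k_n kE] := idem_index (idp_idem d).
  have := P4b i j k i_n j_n k_n; rewrite iE jE kE !cadd_cls !inCH_cls; apply=> //.
  + by move=> ij; apply: xy; apply/cls_eq; rewrite -iE -jE ij.
  + by move=> ik; apply: Kd; rewrite /K; apply/inCH_cls; rewrite -kE -ik iE; apply/inCH_cls.
  + by move=> jk; apply: Kd; rewrite /K; apply/inCH_cls; rewrite -kE -jk jE; apply/inCH_cls.
Qed.

End Clifford.

(** * The sum $e_n$ absorbs all idempotents and lies in $\mathcal C_H$ *)

Section AbsorbingIdempotent.
Variables (U : zmodType) (P : choiceType) (H : FM U P -> Prop).
Implicit Types (x y a b z f : FM U P).

Local Notation "x =~ y" := (heq H x y) (at level 70).

Lemma foldl_cadd (e : nat -> Cls U P) (s : seq nat) a :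
  (forall i, i \in s -> exists f, e i = cls H f) ->
  exists2 b, foldl (cadd H) (cls H a) [seq e i | i <- s] = cls H b &
    (exists x, b = a ** x) /\
    forall i f, i \in s -> e i = cls H f -> exists x, b =~ f ** x.
Proof.
elim: s a => [|j s IHs] a es /=.
  by exists a => //; split=> //; exists (fone U P); rewrite fmul1.
have [f fE] := es j (mem_head _ _); rewrite fE cadd_cls.
have [i si|b bE [[x xE] bs]] := IHs (a ** f); first by apply: es; rewrite inE si orbT.
exists b => //; split=> [|i g]; first by exists (f ** x); rewrite xE -fmulA.
rewrite inE => /orP[/eqP -> | /bs]; last exact.
rewrite fE => /cls_eq fg; exists (a ** x); rewrite -fg xE.
by have -> : a ** f ** x = f ** (a ** x) by fac.
Qed.

(** Up to equivalence $z$ is a multiple of each idempotent $f$, and $f^2 \sim f$. *)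
Lemma sum_idem_absorb (e : nat -> Cls U P) n z :
  (forall X, idem H (inC H) X <-> exists2 i, (i <= n)%N & X = e i) ->
  foldl (cadd H) (e 0%N) [seq e i | i <- iota 1 n] = e n -> e n = cls H z ->
  forall f, f ** f =~ f -> z ** f =~ z.
Proof.
move=> idemP en nz f ff.
have eI i : (i <= n)%N -> exists g, e i = cls H g.
  by move=> i_n; have /idemP[] : exists2 j, (j <= n)%N & e i = e j by exists i.
have [i i_n fE] : exists2 i, (i <= n)%N & cls H f = e i.
  by apply/idemP; split; [exists f | rewrite cadd_cls; apply/cls_eq].
have [a aE] := eI 0%N isT.
have [|b + [[x xE] bs]] := @foldl_cadd e (iota 1 n) a.
  by move=> j; rewrite mem_iota add1n ltnS => /andP[_]; apply: eI.
rewrite -aE en nz => /cls_eq zb; rewrite zb.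
suff [y bE] : exists y, b =~ f ** y.
  rewrite bE; have -> : f ** y ** f = f ** f ** y by fac.
  by rewrite ff.
(* Index 0 is the initial value of the fold and does not occur in [iota 1 n]. *)
case: i i_n fE => [_ | i i_n fE].
  rewrite aE => /cls_eq fa; exists x; rewrite xE -fa.
  exact: heq_refl.
by apply: (bs i.+1) => //; rewrite mem_iota.
Qed.

(** Density gives $h = py \in H$ with $p$ a prime of class $[z]$, and $h^m \sim z y^m \sim z$. *)
Lemma dense_absorbing_mem z m : submonoid H -> dense H -> (0 < m)%N ->
  (forall y, exists p, y =~ fprime U p) ->
  z ** z =~ z -> (forall y, z ** fexp y m =~ z) -> H z.
Proof.
move=> Hmon Hd m_gt0 Hp zz zA; have [p pE] := Hp z.
(* The exponent [k.+1] is positive, so $p$ divides $h$. *)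
have [_ [_ [k kP]]] := Hd p; have [h [Hh hE]] := kP k.+1 (leqnSn k).
have /fdvdP[y yE] : p \in h.2 by rewrite in_mset; move: hE; rewrite /vp => ->.
have := memX Hmon m Hh; rewrite yE fexpMn -pE.
by case: m m_gt0 zA => // l _ zA; rewrite fexp_idem // zA.
Qed.

End AbsorbingIdempotent.

Theorem theorem4p2 (U : zmodType) (P : choiceType) (H : FM U P -> Prop)
  (n : nat) (e : nat -> Cls U P) :
  submonoid H ->
  units_cond H -> C_monoid H -> seminormal H -> dense H ->
  (* idempotents of C and of Cstar are exactly e_0..e_n, distinct *)
  (forall X, idem H (inC H) X <-> exists2 i, (i <= n)%N & X = e i) ->
  (forall X, idem H (inCstar H) X <-> exists2 i, (i <= n)%N & X = e i) ->
  (forall i j, (i <= n)%N -> (j <= n)%N -> e i = e j -> i = j) ->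
  e 0%N = cls H (fone U P) ->
  foldl (cadd H) (e 0%N) [seq e i | i <- iota 1 n] = e n ->
  (* every class of Cstar contains a prime *)
  (forall X, inCstar H X -> exists p : P, X (fprime U p)) ->
  half_factorial H <->
  [/\
   (* (P1) |C_n'| <= 2 *)
   (exists g1 g2, cgroup H (inCstar H) (e n) g1 /\ cgroup H (inCstar H) (e n) g2 /\
     forall g, cgroup H (inCstar H) (e n) g ->
       coset H (e n) g = coset H (e n) g1 \/ coset H (e n) g = coset H (e n) g2),
   (* (P2) *)
   (forall i, (i <= n)%N ->
     (inCH H (e i) ->
       forall g, (cgroup H (inCstar H) (e i) g /\ in_phi_img H (e n) (cadd H g (e n)))
                 <-> in_phi_img H (e i) g) /\
     (~ inCH H (e i) ->
       forall g, (cgroup H (inCstar H) (e i) g /\ in_phi_img H (e n) (cadd H g (e n)))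
                 <-> cgroup H (inC H) (e i) g)),
   (* (P3) *)
   (forall i j, (i <= n)%N -> (j <= n)%N -> i <> j ->
     inCH H (e i) -> inCH H (e j) ->
     forall X, (inCU H X /\ cadd H (cadd H X (e i)) (e j) = cadd H (e i) (e j))
               <-> exists X1 X2, ker_phi H (e i) X1 /\ ker_phi H (e j) X2 /\
                                 X = cadd H X1 X2)
   &
   (* (P4) *)
   (forall X Y, idem H (inCstar H) X -> ~ inCH H X ->
                idem H (inCstar H) Y -> ~ inCH H Y ->
                idem H (inCstar H) (cadd H X Y) /\ ~ inCH H (cadd H X Y)) /\
   (forall i1 i2 j, (i1 <= n)%N -> (i2 <= n)%N -> (j <= n)%N ->
      i1 <> i2 -> i1 <> j -> i2 <> j ->
      inCH H (e i1) -> inCH H (e i2) -> ~ inCH H (e j) ->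
      inCH H (cadd H (cadd H (e i1) (e i2)) (e j)) ->
      inCH H (cadd H (e i1) (e j)) \/ inCH H (cadd H (e i2) (e j)))
  ].
Proof.
move=> Hmon Hunits [_ [k [f fP]]] Hsn Hd idemCP idemP e_inj e0 en CP.
have Hprimes := prime_in_class CP.
have [|m m_gt1 cl] := seminormal_clifford Hmon Hsn.
  by exists k, f => y; apply: fP; apply: inCstar_cls.
have [z e_n zz] := idem_rep Hprimes idemP (leqnn n).
have zA y : heq H (z ** fexp y m) z.
  by apply: (sum_idem_absorb idemCP en e_n); apply: idp_idem.
have Hz := dense_absorbing_mem Hmon Hd (ltnW m_gt1) Hprimes zz zA.
have P1 := cond_P1E Hmon m_gt1 cl Hprimes Hz zA e_n.
have P2 := cond_P2E Hmon m_gt1 cl Hprimes Hz zA idemP e_n.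
have P3 := cond_P3E Hmon m_gt1 cl Hprimes idemP.
have P4 := cond_P4E Hmon m_gt1 cl Hprimes idemP.
split=> [hf | [/P1 c1 /P2 c2 /P3 c3 /P4 c4]]; last first.
  exact: (cond_half_factorial Hmon m_gt1 cl Hunits Hz zA c1 c2 c3 c4).
split.
- by apply/P1; exact: (half_factorial_P1 Hmon m_gt1 cl Hunits Hprimes Hz zA hf).
- by apply/P2; exact: (half_factorial_P2 Hmon m_gt1 cl Hunits Hprimes Hz zA hf).
- by apply/P3; exact: (half_factorial_P3 Hmon m_gt1 cl Hunits Hprimes hf).
- by apply/P4; exact: (half_factorial_P4 Hmon m_gt1 cl Hunits Hprimes hf).
Qed.
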